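(* Let $n,k$ be positive integers with $k\le n/2$. Consider any set $S$ and function $F:\{0,1\}^n\to S$ such that $F(x_1,\dots,x_n)$ only depends on $x_1,\dots,x_{s}$ (for some $s\le n$). Let $\vec \sigma$ be uniformly distributed on $\operatorname{Slice}(n,k)$ and let $\vec \beta$ be a vector of $n$ independent $\operatorname{Bernoulli}(k/n)$ random variables. Then \[\operatorname d_{\mathrm{TV}}\!\big(F(\vec \sigma),F(\vec \beta)\big)\leq \frac{\max(s,2n/k)-1}{n-1}.\]
   Context: $\operatorname{Slice}(n,k)$ is the set of vectors in $\{0,1\}^n$ with exactly $k$ entries equal to $1$. For probability distributions (or random variables) $\mu,\nu$ on the same space, the total variation distance $\operatorname{d}_{\mathrm{TV}}(\mu,\nu)$ is the supremum of $|\mu(A)-\nu(A)|$ over all events $A$. *)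

(* Defs.v *)
From HB Require Import structures.
From mathcomp Require Import all_boot all_order all_algebra.
From mathcomp Require Import all_classical all_reals all_analysis.

Set Implicit Arguments.
Unset Strict Implicit.
Unset Printing Implicit Defensive.

Import Order.TTheory GRing.Theory Num.Theory.

Local Open Scope classical_set_scope.
Local Open Scope ring_scope.

Definition Slice (n k : nat) : {set n.-tuple bool} :=
  [set x : n.-tuple bool | count_mem true x == k]%SET.

(* [P] only needs to be applied to preimages, so that the target is an arbitrary
   type rather than a (necessarily pointed) measurableType as in [distribution]. *)
Definition law d (T : measurableType d) (R : realType) (P : probability T R)
    (S : Type) (X : T -> S) : set S -> \bar R :=
  fun A => P (X @^-1` A).

(* [events] is the sigma-algebra on which [mu] and [nu] are considered. *)
Definition dTV (R : realType) (S : Type) (events : set (set S))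
    (mu nu : set S -> \bar R) : \bar R :=
  ereal_sup [set `|mu A - nu A|%E | A in events].

Definition uniformly_distributed d (T : measurableType d) (R : realType)
    (P : probability T R) n (X : {RV P >-> n.-tuple bool})
    (D : {set n.-tuple bool}) : Prop :=
  forall x : n.-tuple bool,
    distribution P X [set x] = ((x \in D)%:R / #|D|%:R)%:E.

Definition mutually_independent d d' (T : measurableType d)
    (T' : measurableType d') (R : realType) (P : probability T R)
    (I : finType) (X : I -> {RV P >-> T'}) : Prop :=
  forall (J : {set I}) (A : I -> set T'), (forall i, measurable (A i)) ->
    P (\bigcap_(i in [set` J]) (X i @^-1` A i)) =
    (\prod_(i in J) P (X i @^-1` A i))%E.

Definition depends_only_on_first n (s : nat) (S : Type)
    (F : n.-tuple bool -> S) : Prop :=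
  forall x y : n.-tuple bool,
    (forall i : 'I_n, (i < s)%N -> tnth x i = tnth y i) -> F x = F y.

(* Main.v *)
Require Import Defs.
From HB Require Import structures.
From mathcomp Require Import all_boot all_order all_algebra.
From mathcomp Require Import all_classical all_reals all_analysis.
From mathcomp Require Import zify ring lra.

(**
Since an event read off the first [s] coordinates has the same conditional
probability given the number [W] of ones among them under both laws, it suffices
to compare the hypergeometric and binomial laws of [W] against test functions
[h] with values in [[0, 1]], which is done by Stein's method.  With [p = k / n],
[q = 1 - p] and [f] the solution of
[[(s - j) p f(j + 1) - j q f(j) = h(j) - E h(Bin(s, p))],]
the Stein identity of the hypergeometric law
[[E ((s - W) (k - W) f(W + 1)) = E (W (n - k - s + W) f(W))]]
gives [E h(W) - E h(Bin(s, p)) = E (W (s - W) (f(W + 1) - f(W))) / n].  The same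
identity for [f = 1] and [f(j) = j - 1] yields
[E (W (s - W)) = s (s - 1) k (n - k) / (n (n - 1))], and
[|f(j + 1) - f(j)| <= 1 / (s p q)] for [0 < j < s], so that the distance is at most
[(s - 1) / (n - 1)] for every [s >= 1].
*)

Set Implicit Arguments.
Unset Strict Implicit.

Import Order.TTheory GRing.Theory Num.Theory.

Local Open Scope ring_scope.

(** * Increments of the Stein solution *)

(* At a point [j], the binomial masses below, at and above [j] are [L], [b] and [U],
   their [h]-weighted versions are [a1], [a2] and [a3], [alpha = (s - j) p] and
   [beta = j q].  Written as a combination of [a1], [a2], [a3], the increment of
   the Stein solution has nonpositive coefficients on [a1] and [a3]. *)
Lemma stein_factor_ub (R : realFieldType) (L b U alpha beta gamma a1 a2 a3 : R) :
  0 < b -> L + b + U = 1 -> 0 < alpha -> 0 < beta ->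
  U * beta <= (b + U) * alpha -> L * alpha <= (L + b) * beta ->
  0 <= a1 -> 0 <= a2 <= b -> 0 <= a3 ->
  0 < gamma -> (gamma <= alpha) || (gamma <= beta) ->
  (a1 + a2 - (L + b) * (a1 + a2 + a3)) / (alpha * b)
    - (a1 - L * (a1 + a2 + a3)) / (beta * b) <= gamma^-1.
Proof.
move=> b0 LbU al0 be0 Ube Lal a1_ge0 /andP[a2_ge0 a2b] a3_ge0 ga0 gaM.
have {LbU} LE : L = 1 - b - U by lra.
have c1 : U / alpha <= (b + U) / beta by rewrite ler_pdivlMr// mulrAC ler_pdivrMr.
have c3 : L / beta <= (L + b) / alpha by rewrite ler_pdivlMr// mulrAC ler_pdivrMr.
have -> : (a1 + a2 - (L + b) * (a1 + a2 + a3)) / (alpha * b)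
    - (a1 - L * (a1 + a2 + a3)) / (beta * b) =
    (a1 * (U / alpha - (b + U) / beta) + a2 * (U / alpha + L / beta)
    + a3 * (L / beta - (L + b) / alpha)) / b.
  by rewrite LE; field; rewrite !lt0r_neq0.
(* As the three masses sum to 1, [c3] collapses the left side to [alpha^-1] and [c1] to [beta^-1];
   the larger rate is the one to use. *)
have c2 : U / alpha + L / beta <= gamma^-1.
  have /orP[ga|ga] := gaM.
    apply: (@le_trans _ _ alpha^-1); last by rewrite lef_pV2 ?posrE.
    rewrite [leRHS](_ : _ = U / alpha + (L + b) / alpha); last first.
      by rewrite LE; field; rewrite lt0r_neq0.
    by rewrite lerD2l.
  apply: (@le_trans _ _ beta^-1); last by rewrite lef_pV2 ?posrE.
  rewrite [leRHS](_ : _ = (b + U) / beta + L / beta); last first.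
    by rewrite LE; field; rewrite lt0r_neq0.
  by rewrite lerD2r.
have ga'0 : 0 <= gamma^-1 by rewrite invr_ge0 ltW.
rewrite ler_pdivrMr// mulrC.
have d1 : a1 * (U / alpha - (b + U) / beta) <= 0 by rewrite mulr_ge0_le0// subr_le0.
have d3 : a3 * (L / beta - (L + b) / alpha) <= 0 by rewrite mulr_ge0_le0// subr_le0.
have d2 : a2 * (U / alpha + L / beta) <= b * gamma^-1.
  by apply: (le_trans (ler_wpM2l a2_ge0 c2)); rewrite ler_wpM2r.
lra.
Qed.

Lemma stein_factor_abs (R : realFieldType) (L b U alpha beta gamma a1 a2 a3 : R) :
  0 < b -> L + b + U = 1 -> 0 < alpha -> 0 < beta ->
  U * beta <= (b + U) * alpha -> L * alpha <= (L + b) * beta ->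
  0 <= a1 <= L -> 0 <= a2 <= b -> 0 <= a3 <= U ->
  0 < gamma -> (gamma <= alpha) || (gamma <= beta) ->
  `|(a1 + a2 - (L + b) * (a1 + a2 + a3)) / (alpha * b)
    - (a1 - L * (a1 + a2 + a3)) / (beta * b)| <= gamma^-1.
Proof.
move=> b0 LbU al0 be0 Ube Lal /andP[a1_ge0 a1L] /andP[a2_ge0 a2b] /andP[a3_ge0 a3U].
move=> ga0 gaM.
rewrite ler_norml; apply/andP; split; last first.
  by apply: (@stein_factor_ub _ L b U) => //; rewrite ?a2_ge0.
(* The lower bound is the upper bound for the test function [1 - h]. *)
rewrite lerNl.
have := @stein_factor_ub _ L b U alpha beta gamma (L - a1) (b - a2) (U - a3)
  b0 LbU al0 be0 Ube Lal.
have -> : L - a1 + (b - a2) + (U - a3) = 1 - (a1 + a2 + a3) by lra.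
set x := _ - _ / _ => H; set y := (X in X <= _).
have -> : y = x by rewrite /x /y; field; rewrite !lt0r_neq0.
by apply: H; rewrite ?subr_ge0// a2b gerBl.
Qed.

(** The recurrence is detailed balance for a birth-death chain with birth rate [(s - i) p],
    decreasing in [i], and death rate [i q], increasing in [i]. This monotonicity gives the two tail
    inequalities of [stein_factor_abs]. *)
Lemma stein_factor_birth_death (R : realFieldType) (b h : nat -> R) (s j : nat)
    (p q : R) :
  0 < p -> 0 < q -> p + q = 1 ->
  (forall i, (i <= s)%N -> 0 < b i) ->
  (forall i, (i < s)%N ->
     (s%:R - i%:R) * p * b i = i.+1%:R * q * b i.+1) ->
  \sum_(0 <= i < s.+1) b i = 1 ->
  (forall i, 0 <= h i <= 1) ->
  let g := fun m => \sum_(0 <= i < m) b i * h i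
    - (\sum_(0 <= i < m) b i) * \sum_(0 <= i < s.+1) b i * h i in
  (0 < j < s)%N ->
  `|g j.+1 / (j.+1%:R * q * b j.+1) - g j / (j%:R * q * b j)|
    <= (s%:R * p * q)^-1.
Proof.
move=> p0 q0 pq b0 rec sb1 h01 g /andP[j0 js].
have bh i : (i <= s)%N -> 0 <= b i * h i <= b i.
  by move=> /b0 /ltW bi; case/andP: (h01 i) => h0 h1; rewrite mulr_ge0//= ler_piMr.
have split3 (c : nat -> R) : \sum_(0 <= i < s.+1) c i =
    \sum_(0 <= i < j) c i + c j + \sum_(j.+1 <= i < s.+1) c i.
  rewrite (@big_cat_nat _ _ _ j)//=; last by rewrite ltnW// ltnW.
  by rewrite -addrA; congr +%R; rewrite big_ltn// ltnW.
rewrite -rec// {}/g !(big_nat_recr j)//= (split3 (fun i => b i * h i)).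
move: sb1; rewrite split3 => sb1.
have jR : 0 < j%:R :> R by rewrite ltr0n.
have jsR : 0 < s%:R - j%:R :> R by rewrite subr_gt0 ltr_nat.
have bj : 0 < b j by apply/b0/ltnW.
apply: (@stein_factor_abs _ _ _ (\sum_(j.+1 <= i < s.+1) b i)) => //.
- by rewrite mulr_gt0.
- by rewrite mulr_gt0.
(* Above [j] the death rates are at least [j q]. Detailed balance turns the death flow there into
   the birth flow from [j] on, whose rates are at most [(s - j) p]. *)
- rewrite mulrC mulr_sumr.
  rewrite (@le_trans _ _ (\sum_(j.+1 <= i < s.+1) i%:R * q * b i))//.
    apply: ler_sum_nat => i /andP[ji i_s]; rewrite ler_wpM2r ?ler_wpM2r ?ler_nat//.
    + exact/ltW/b0.
    + exact: ltW.
    + exact: ltnW.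
  rewrite big_add1 /=.
  under eq_big_nat => i /andP[_ i_s] do rewrite -rec//.
  have -> : b j + \sum_(j.+1 <= i < s.+1) b i = \sum_(j <= i < s) b i + b s.
    by rewrite -big_ltn 1?ltnW// big_nat_recr//= ltnW.
  rewrite mulrDl -[leLHS]addr0 lerD//; last first.
    by rewrite !mulr_ge0 ?ltW// b0.
  rewrite mulrC mulr_sumr; apply: ler_sum_nat => i /andP[ji i_s].
  rewrite ler_wpM2r ?ler_wpM2r//; [exact/ltW/b0/ltnW|exact: ltW|].
  by rewrite lerB// ler_nat.
(* Mirror image below [j]: birth flow is bounded below, then turned into death flow. *)
- rewrite mulrC mulr_sumr.
  rewrite (@le_trans _ _ (\sum_(0 <= i < j) (s%:R - i%:R) * p * b i))//.
    apply: ler_sum_nat => i /andP[_ ij]; rewrite ler_wpM2r ?ler_wpM2r//.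
    + exact/ltW/b0/ltnW/(ltn_trans ij).
    + exact: ltW.
    + by rewrite lerB// ler_nat ltnW.
  have -> : \sum_(0 <= i < j) (s%:R - i%:R) * p * b i =
      \sum_(0 <= i < j) i.+1%:R * q * b i.+1.
    by apply: eq_big_nat => i /andP[_ ij]; rewrite rec// (ltn_trans ij).
  rewrite -big_nat_recr//= big_nat_recl// mulrDl -[leLHS]add0r lerD//.
    by rewrite !mulr_ge0 ?ltW// b0.
  rewrite mulrC mulr_sumr; apply: ler_sum_nat => i /andP[_ ij].
  rewrite ler_wpM2r ?ler_wpM2r ?ler_nat//; last exact: ltW.
  exact/ltW/b0/(leq_trans _ (ltnW js)).
- apply/andP; split.
    rewrite big_nat_cond sumr_ge0// => i /andP[/andP[_ ij] _].
    by case/andP: (bh i (ltnW (ltn_trans ij js))).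
  apply: ler_sum_nat => i /andP[_ ij].
  by case/andP: (bh i (ltnW (ltn_trans ij js))).
- exact/bh/ltnW.
- apply/andP; split.
    rewrite big_nat_cond sumr_ge0// => i /andP[/andP[_ ij] _].
    by case/andP: (bh i ij).
  by apply: ler_sum_nat => i /andP[_ ij]; case/andP: (bh i ij).
- by rewrite !mulr_gt0// ltr0n (ltn_trans j0).
(* The average of the two rates with weights [q] and [p] is exactly [s p q], so they cannot both be
   smaller. *)
- rewrite -(negbK (_ || _)) negb_or -!ltNge; apply/negP => /andP[H1 H2].
  move: (mulr_gt0 q0 jsR) (mulr_gt0 p0 jR) => A B.
  have : q * ((s%:R - j%:R) * p) + p * (j%:R * q)
      < q * (s%:R * p * q) + p * (s%:R * p * q).
    by rewrite ltrD// ltr_pM2l.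
  rewrite -mulrDl [q + p]addrC pq mul1r.
  have -> : q * ((s%:R - j%:R) * p) + p * (j%:R * q) = s%:R * p * q by ring.
  by rewrite ltxx.
Qed.

(** * Hypergeometric against binomial weights *)

(** A shift of the index: the boundary terms vanish through the factors [s - j] at [j = s] and [j]
    at [j = 0]. Here [t] stands for [n - s]. *)
Lemma hypergeometric_stein_identity (R : comNzRingType) (w phi : nat -> R) (s : nat)
    (k t : R) :
  (forall j, (j < s)%N -> w j.+1 * (j.+1%:R * (t - k + j.+1%:R)) =
     w j * ((s%:R - j%:R) * (k - j%:R))) ->
  \sum_(0 <= j < s.+1) w j * ((s%:R - j%:R) * (k - j%:R)) * phi j.+1 =
  \sum_(0 <= j < s.+1) w j * (j%:R * (t - k + j%:R)) * phi j.
Proof.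
move=> rec.
rewrite big_nat_recr//= subrr !(mul0r, mulr0) addr0.
rewrite [RHS]big_nat_recl//= !(mul0r, mulr0) add0r.
by apply: eq_big_nat => j /andP[_ js]; rewrite rec.
Qed.

Lemma hypergeometric_mixed_moment (R : comNzRingType) (w : nat -> R) (s : nat)
    (k t : R) :
  (forall j, (j < s)%N -> w j.+1 * (j.+1%:R * (t - k + j.+1%:R)) =
     w j * ((s%:R - j%:R) * (k - j%:R))) ->
  \sum_(0 <= j < s.+1) w j = 1 ->
  let n := s%:R + t in
  n * (n - 1) * (\sum_(0 <= j < s.+1) w j * (j%:R * (s%:R - j%:R))) =
  s%:R * (s%:R - 1) * k * (n - k).
Proof.
move=> rec w1 n.
have H1 := @hypergeometric_stein_identity _ w (fun=> 1) s k t rec.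
have H2 := @hypergeometric_stein_identity _ w (fun j => j%:R - 1) s k t rec.
move/eqP : H1; rewrite -subr_eq0 -sumrB => /eqP H1.
move/eqP : H2; rewrite -subr_eq0 -sumrB => /eqP H2.
transitivity (s%:R * (s%:R - 1) * k * (n - k) * \sum_(0 <= j < s.+1) w j).
  apply/eqP; rewrite -subr_eq0; apply/eqP.
  (* With these coefficients each summand is [w j] times [n (n - 1) j (s - j) - s (s - 1) k (n -
     k)], so the claim becomes a polynomial identity in [j]. *)
  have := congr2 (fun x y => n * x - (s%:R - 1) * (n - k) * y) H2 H1.
  rewrite /= !mulr0 subr0 => H; rewrite -[RHS]H !mulr_sumr -!sumrB.
  by apply: eq_bigr => j _; rewrite /n -[j.+1]addn1 natrD; ring.
by rewrite w1 mulr1.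
Qed.

Lemma hypergeometric_binomial_stein (R : realFieldType) (w b h : nat -> R)
    (s : nat) (k t : R) :
  let n := s%:R + t in
  1 < n -> 0 < k < n ->
  (forall i, (i <= s)%N -> 0 < b i) ->
  (forall i, (i < s)%N ->
     (s%:R - i%:R) * (k / n) * b i = i.+1%:R * ((n - k) / n) * b i.+1) ->
  \sum_(0 <= i < s.+1) b i = 1 ->
  (forall j, 0 <= w j) ->
  (forall j, (j < s)%N -> w j.+1 * (j.+1%:R * (t - k + j.+1%:R)) =
     w j * ((s%:R - j%:R) * (k - j%:R))) ->
  \sum_(0 <= j < s.+1) w j = 1 ->
  (forall i, 0 <= h i <= 1) ->
  (0 < s)%N ->
  `|\sum_(0 <= j < s.+1) w j * h j - \sum_(0 <= j < s.+1) b j * h j|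
    <= (s%:R - 1) / (n - 1).
Proof.
move=> n n1 /andP[k0 kn] b0 brec b1 w0 wrec w1 h01 s0.
have n0 : 0 < n by rewrite (lt_trans _ n1).
have nk0 : 0 < n - k by rewrite subr_gt0.
set p := k / n; set q := (n - k) / n.
have p0 : 0 < p by rewrite divr_gt0.
have q0 : 0 < q by rewrite divr_gt0.
have pq : p + q = 1 by rewrite /p /q; field; rewrite lt0r_neq0.
set Bh := \sum_(0 <= j < s.+1) b j * h j.
pose g m := \sum_(0 <= i < m) b i * h i - (\sum_(0 <= i < m) b i) * Bh.
(* At [m = 0] the division by zero gives 0, which is harmless since [g 0 = 0]; the value at [s.+1]
   only occurs multiplied by [s - s]. *)
pose f m := g m / (m%:R * q * b m).
have fE j : (j <= s)%N -> j%:R * q * b j * f j = g j.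
  case: j => [|j] js; first by rewrite !mul0r /g !big_geq// mul0r subr0.
  by rewrite /f mulrC divfK// lt0r_neq0// mulr_gt0 ?b0// mulr_gt0 ?ltr0n.
have gs : g s.+1 = 0 by rewrite /g b1 mul1r subrr.
have fSE j : (j <= s)%N -> (s%:R - j%:R) * p * b j * f j.+1 = g j.+1.
  rewrite leq_eqVlt => /predU1P[->|js]; first by rewrite subrr !mul0r gs.
  by rewrite brec// fE.
have stein j : (j <= s)%N ->
    (s%:R - j%:R) * p * f j.+1 - j%:R * q * f j = h j - Bh.
  move=> js; apply: (mulfI (lt0r_neq0 (b0 j js))).
  have -> : b j * ((s%:R - j%:R) * p * f j.+1 - j%:R * q * f j) =
      (s%:R - j%:R) * p * b j * f j.+1 - j%:R * q * b j * f j by ring.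
  rewrite fSE// fE// /g !big_nat_recr//=; ring.
have df j : (j <= s)%N ->
    `|j%:R * (s%:R - j%:R) * (f j.+1 - f j)| <=
    j%:R * (s%:R - j%:R) * (s%:R * p * q)^-1.
  move=> js; have jsR : 0 <= s%:R - j%:R :> R by rewrite subr_ge0 ler_nat.
  rewrite normrM ger0_norm ?mulr_ge0//.
  have [->|j0] := posnP j; first by rewrite !mul0r.
  move: js; rewrite leq_eqVlt => /predU1P[->|js].
    by rewrite subrr mulr0 !mul0r.
  by rewrite ler_wpM2l ?mulr_ge0// stein_factor_birth_death// j0.
(* Average the Stein equation over [w] and subtract [n^-1] times the hypergeometric identity: both
   coefficients reduce to [j (s - j) / n], because [n - t = s]. *)
have -> : \sum_(0 <= j < s.+1) w j * h j - Bh =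
    n^-1 * \sum_(0 <= j < s.+1) w j * (j%:R * (s%:R - j%:R) * (f j.+1 - f j)).
  have := @hypergeometric_stein_identity _ w f s k t wrec.
  move/eqP; rewrite -subr_eq0 -sumrB => /eqP H.
  rewrite -[X in _ - X = _]mulr1 -[X in _ - _ * X = _]w1 mulr_sumr -sumrB.
  rewrite -[RHS]addr0 -[X in _ = _ + X](mulr0 n^-1) -[X in _ = _ + _ * X]H.
  rewrite !mulr_sumr -big_split/=.
  apply: eq_big_nat => j /andP[_ js].
  rewrite [Bh * _]mulrC -mulrBr -stein// /p /q.
  by rewrite /n; field; rewrite lt0r_neq0.
have n'0 : 0 <= n^-1 by rewrite invr_ge0 ltW.
rewrite normrM ger0_norm//.
have mom := @hypergeometric_mixed_moment _ w s k t wrec w1.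
have sR : 0 < s%:R :> R by rewrite ltr0n.
have -> : (s%:R - 1) / (n - 1) = n^-1 * ((s%:R * p * q)^-1 *
    \sum_(0 <= j < s.+1) w j * (j%:R * (s%:R - j%:R))).
  have n10 : n - 1 != 0 by rewrite lt0r_neq0// subr_gt0.
  have -> : \sum_(0 <= j < s.+1) w j * (j%:R * (s%:R - j%:R)) =
      s%:R * (s%:R - 1) * k * (n - k) / (n * (n - 1)).
    by rewrite -mom mulrAC mulfV ?mul1r// mulf_neq0// lt0r_neq0.
  by rewrite /p /q; field; rewrite n10 !lt0r_neq0.
rewrite ler_wpM2l// mulr_sumr.
apply: (le_trans (ler_norm_sum _ _ _)).
apply: ler_sum_nat => j /andP[_ js]; rewrite normrM ger0_norm//.
by rewrite mulrCA ler_wpM2l// [leRHS]mulrC df.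
Qed.

(** * Sums over Boolean tuples, grouped by the number of ones in a prefix *)

Lemma sum_tuple_cat (V : nmodType) (T : finType) (s t : nat)
    (G : (s + t).-tuple T -> V) :
  \sum_x G x = \sum_(y : s.-tuple T) \sum_(z : t.-tuple T) G (cat_tuple y z).
Proof.
rewrite pair_bigA /= (reindex (fun yz => cat_tuple yz.1 yz.2))//=.
apply: onW_bij; apply: inj_card_bij; last first.
  by rewrite card_prod !card_tuple expnD.
move=> [y z] [y' z'] /(congr1 val)/= /eqP.
by rewrite eqseq_cat ?size_tuple// => /andP[/eqP/val_inj -> /eqP/val_inj ->].
Qed.

(** A Boolean vector is identified with its support, a subset of ['I_n]. *)
Lemma card_Slice (n k : nat) : #|Slice n k| = 'C(n, k).
Proof.
pose f (x : n.-tuple bool) := [set i | tnth x i].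
have fI : injective f.
  move=> x y /setP xy; apply: eq_from_tnth => i.
  by have := xy i; rewrite !inE.
have cf x : #|f x| = count_mem true x.
  rewrite -sum1_card -sum1_count big_tuple; apply: eq_bigl => i.
  by rewrite inE; case: (tnth x i).
have fB : bijective f.
  apply: (inj_card_bij fI).
  by rewrite -cardsT -powersetT card_powerset cardsT card_ord card_tuple card_bool.
rewrite -(card_imset _ fI) -[n in 'C(n, k)]card_ord -card_draws.
congr #|pred_of_set _|; apply/setP => B; rewrite inE.
have [g fK gK] := fB; apply/imsetP/eqP => [[x + ->]|Bk].
  by rewrite inE cf => /eqP.
by exists (g B); rewrite ?gK// inE -cf gK Bk.
Qed.

Lemma sum_count_mem (V : nmodType) (n : nat) (A : pred (n.-tuple bool))
    (G : nat -> V) :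
  \sum_(x : n.-tuple bool | A x) G (count_mem true x) =
  \sum_(0 <= j < n.+1) G j *+ #|[set x | A x & count_mem true x == j]|.
Proof.
have le_n (x : n.-tuple bool) : (count_mem true x < n.+1)%N.
  by rewrite ltnS (leq_trans (count_size _ _))// size_tuple.
rewrite (partition_big (fun x => Ordinal (le_n x)) predT)//= big_mkord.
apply: eq_bigr => j _; rewrite -sumr_const; apply: eq_big => [x|x /andP[_ /eqP <-]//].
by rewrite inE -val_eqE.
Qed.

Lemma prod_bernoulli_weight (R : comNzRingType) (p q : R) (x : seq bool) :
  \prod_(c <- x) (if c then p else q) =
  p ^+ count_mem true x * q ^+ (size x - count_mem true x).
Proof.
elim: x => [|[] x IH]; rewrite ?big_nil ?mulr1// big_cons IH /=.
  by rewrite exprS mulrA.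
by rewrite add0n subSn ?count_size// exprS mulrCA.
Qed.

Lemma sum_bernoulli_weight (R : comNzRingType) (p q : R) (t : nat) :
  \sum_(z : t.-tuple bool) \prod_(c <- z) (if c then p else q) = (p + q) ^+ t.
Proof.
under eq_bigr => z _ do rewrite prod_bernoulli_weight size_tuple.
rewrite (sum_count_mem _ (fun j => p ^+ j * q ^+ (t - j))) addrC exprDn big_mkord.
by apply: eq_bigr => j _; rewrite mulrC -card_Slice.
Qed.

(** The subtraction takes place in [R]; it differs from the truncated one only for [m > n], where
    the binomial coefficient is 0. *)
Lemma natr_bin_left (R : comNzRingType) (n m : nat) :
  m.+1%:R * 'C(n, m.+1)%:R = (n%:R - m%:R) * 'C(n, m)%:R :> R.
Proof.
rewrite -natrM mul_bin_left; have [mn|nm] := leqP m n; first by rewrite natrM natrB.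
by rewrite bin_small// muln0 mulr0.
Qed.

(* For [A] depending on the first [s] coordinates only, the padding is immaterial. *)
Definition prefix_count (s t : nat) (A : pred ((s + t).-tuple bool)) (j : nat) :=
  #|[set y : s.-tuple bool | A (cat_tuple y (nseq_tuple t false))
                           & count_mem true y == j]|.

Lemma prefix_count_le (s t : nat) (A : pred ((s + t).-tuple bool)) (j : nat) :
  (prefix_count A j <= 'C(s, j))%N.
Proof.
rewrite -card_Slice subset_leq_card//; apply/fintype.subsetP => y.
by rewrite !inE => /andP[].
Qed.

(** Both laws satisfy the hypothesis on [G]: once the last [t] coordinates are summed out, a prefix
    is weighted by its number of ones alone, so the event matters only through [prefix_count]. *)
Lemma sum_prefix (R : comNzRingType) (s t : nat) (A : pred ((s + t).-tuple bool))
    (G : (s + t).-tuple bool -> R) (W : nat -> R) :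
  depends_only_on_first s A ->
  (forall y : s.-tuple bool,
     \sum_(z : t.-tuple bool) G (cat_tuple y z) = W (count_mem true y)) ->
  \sum_(x | A x) G x = \sum_(0 <= j < s.+1) W j *+ prefix_count A j.
Proof.
move=> A_dep GW; rewrite -sum_count_mem big_mkcond sum_tuple_cat [RHS]big_mkcond.
apply: eq_bigr => y _; rewrite -GW.
have Ay z : A (cat_tuple y z) = A (cat_tuple y (nseq_tuple t false)).
  apply: A_dep => i i_s; rewrite !(tnth_nth false) !nth_cat size_tuple.
  by rewrite i_s.
under eq_bigr => z _ do rewrite Ay.
by case: ifP => // _; rewrite big1.
Qed.

(** The factor [(j <= k)%:R] guards against truncation: for [j > k] one has [k - j = 0], and
    ['C(t, 0)] would wrongly contribute 1. *)
Lemma sum_Slice (R : fieldType) (s t k : nat) (A : pred ((s + t).-tuple bool)) :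
  depends_only_on_first s A ->
  \sum_(x | A x) (x \in Slice (s + t) k)%:R / #|Slice (s + t) k|%:R =
  \sum_(0 <= j < s.+1)
    ((j <= k)%:R * 'C(t, k - j)%:R / 'C(s + t, k)%:R) *+ prefix_count A j :> R.
Proof.
move=> A_dep; apply: sum_prefix => // y; rewrite card_Slice -mulr_suml.
congr (_ / _); case: leqP => [yk|ky].
  rewrite mul1r -card_Slice -sum1_card natr_sum [RHS]big_mkcond/=.
  apply: eq_bigr => z _; rewrite !inE count_cat -[X in _ == X](subnKC yk) eqn_add2l.
  by case: ifP.
rewrite mul0r big1// => z _; rewrite inE count_cat gtn_eqF//.
by rewrite (leq_trans ky)// leq_addr.
Qed.

Lemma sum_bernoulli (R : comNzRingType) (s t : nat) (p q : R)
    (A : pred ((s + t).-tuple bool)) :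
  p + q = 1 -> depends_only_on_first s A ->
  \sum_(x | A x) \prod_(c <- x) (if c then p else q) =
  \sum_(0 <= j < s.+1) (p ^+ j * q ^+ (s - j)) *+ prefix_count A j.
Proof.
move=> pq A_dep; apply: sum_prefix => // y.
under eq_bigr => z _ do rewrite big_cat/=.
rewrite -mulr_sumr sum_bernoulli_weight pq expr1n mulr1.
by rewrite prod_bernoulli_weight size_tuple.
Qed.

Lemma prefix_count_predT (s t j : nat) :
  prefix_count (predT : pred ((s + t).-tuple bool)) j = 'C(s, j).
Proof. by rewrite -card_Slice; apply: eq_card => y; rewrite !inE. Qed.

(** * The distance bound for finite sums *)

Lemma slice_bernoulli_bound (R : realFieldType) (s t k : nat)
    (A : pred ((s + t).-tuple bool)) :
  let n := (s + t)%N in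
  let p := k%:R / n%:R : R in
  (0 < s)%N -> (1 < n)%N -> (0 < k < n)%N ->
  depends_only_on_first s A ->
  `|\sum_(x | A x) (x \in Slice n k)%:R / #|Slice n k|%:R
    - \sum_(x | A x) \prod_(c <- x) (if c then p else 1 - p)|
   <= (s%:R - 1) / (n%:R - 1).
Proof.
move=> n p s0 n1 /andP[k0 kn] A_dep.
have nR : 0 < n%:R :> R by rewrite ltr0n ltnW.
have qE : 1 - p = (n%:R - k%:R) / n%:R by rewrite /p; field; rewrite lt0r_neq0.
have Cn : 'C(n, k)%:R != 0 :> R by rewrite pnatr_eq0 -lt0n bin_gt0 ltnW.
have p0 : 0 < p by rewrite divr_gt0// ltr0n.
have q0 : 0 < 1 - p by rewrite qE divr_gt0// subr_gt0 ltr_nat.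
rewrite sum_Slice// sum_bernoulli//; last by rewrite addrC subrK.
(* [h j] is the conditional probability of [A] given [j] ones in the prefix; [w] and [b] are the
   hypergeometric and binomial masses. *)
pose h j : R := (prefix_count A j)%:R / 'C(s, j)%:R.
pose w j : R := 'C(s, j)%:R * ((j <= k)%:R * 'C(t, k - j)%:R / 'C(n, k)%:R).
pose b j : R := 'C(s, j)%:R * (p ^+ j * (1 - p) ^+ (s - j)).
have hE W : \sum_(0 <= j < s.+1) W j *+ prefix_count A j =
    \sum_(0 <= j < s.+1) 'C(s, j)%:R * W j * h j.
  apply: eq_big_nat => j /andP[_ js].
  rewrite /h [RHS]mulrC mulrA divfK ?mulr_natl//.
  by rewrite pnatr_eq0 -lt0n bin_gt0.
(* The total masses of [w] and [b] are the probabilities of the sure event, so the same two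
   summation lemmas normalize them. *)
have predTE (W : nat -> R) : \sum_(0 <= j < s.+1) 'C(s, j)%:R * W j =
    \sum_(0 <= j < s.+1) W j *+ prefix_count (predT : pred (n.-tuple bool)) j.
  by apply: eq_bigr => j _; rewrite prefix_count_predT mulr_natl.
rewrite !hE natrD.
apply: (@hypergeometric_binomial_stein _ w b h s k%:R t%:R); rewrite -?natrD -/n //.
- by rewrite ltr1n.
- by rewrite ltr0n ltr_nat k0.
- by move=> i i_s; rewrite mulr_gt0 ?ltr0n ?bin_gt0// mulr_gt0// exprn_gt0.
- move=> i i_s; rewrite -qE -/p /b -(subnSK i_s) !exprS.
  have H := natr_bin_left R s i.
  transitivity (((s%:R - i%:R) * 'C(s, i)%:R) *
      (p * p ^+ i * ((1 - p) * (1 - p) ^+ (s - i.+1)))).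
    by ring.
  by rewrite -H; ring.
- rewrite predTE -sum_bernoulli ?sum_bernoulli_weight//; last by rewrite addrC subrK.
  by rewrite addrC subrK expr1n.
- by move=> j; rewrite !mulr_ge0 ?invr_ge0.
(* For [j < k] the ratio comes from two binomial recurrences. For [j > k] both masses vanish, and
   for [j = k] the factor [k - j] does. *)
- move=> j js; rewrite /w; case: (ssrnat.ltngtP j k) => [jk|kj|jk].
  + rewrite !mul1r.
    have H := natr_bin_left R s j.
    have H' := natr_bin_left R t (k - j.+1).
    rewrite subnSK// (natrB _ (ltnW jk)) (natrB _ jk) in H'.
    transitivity (j.+1%:R * 'C(s, j.+1)%:R *
      ((t%:R - (k%:R - j.+1%:R)) * 'C(t, k - j.+1)%:R) / 'C(n, k)%:R : R).
      by ring.
    by rewrite H -H'; ring.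
  + by rewrite !(mul0r, mulr0).
  + by rewrite jk subrr !(mul0r, mulr0).
- rewrite predTE -sum_Slice// -mulr_suml -natr_sum -[X in X%:R / _]big_mkcond.
  by rewrite sum1_card card_Slice mulfV.
- move=> j; rewrite divr_ge0//=.
  have [js|sj] := leqP j s; last first.
    by rewrite /h [in 'C(s,j)]bin_small// invr0 mulr0 ler01.
  by rewrite ler_pdivrMr ?mul1r ?ler_nat ?prefix_count_le// ltr0n bin_gt0.
Qed.

(* [maxn s 1] because [(s - 1) / (n - 1)] is negative at [s = 0]. *)
Lemma slice_bernoulli_bound_le (R : realFieldType) (n s k : nat)
    (A : pred (n.-tuple bool)) :
  let p := k%:R / n%:R : R in
  (s <= n)%N -> (1 < n)%N -> (0 < k < n)%N ->
  depends_only_on_first s A ->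
  `|\sum_(x | A x) (x \in Slice n k)%:R / #|Slice n k|%:R
    - \sum_(x | A x) \prod_(c <- x) (if c then p else 1 - p)|
   <= ((maxn s 1)%:R - 1) / (n%:R - 1).
Proof.
move=> p sn n1 kn A_dep.
have A_dep' : depends_only_on_first (maxn s 1) A.
  by move=> x y xy; apply: A_dep => i i_s; apply: xy; rewrite leq_max i_s.
have s1n : (maxn s 1 <= n)%N by rewrite geq_max sn ltnW.
have s1 : (0 < maxn s 1)%N by rewrite leq_max orbT.
move: (maxn s 1) s1n s1 A_dep' => r rn r0 Ar.
have nE : n = (r + (n - r))%N by rewrite subnKC.
move: (n - r)%N nE => t nE; subst n.
exact: slice_bernoulli_bound.
Qed.

(** * From random variables to finite sums *)

Local Open Scope classical_set_scope.
Local Open Scope ring_scope.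

Lemma probability_preimage_fin d (T : measurableType d) (R : realType)
    (P : probability T R) (U : finType) (X : T -> U) (c : U -> R) (A : pred U) :
  (forall x, measurable (X @^-1` [set x])) ->
  (forall x, P (X @^-1` [set x]) = (c x)%:E) ->
  P (X @^-1` [set x | A x]) = (\sum_(x | A x) c x)%:E.
Proof.
move=> mX Pc.
have -> : X @^-1` [set x | A x] = \bigcup_(x in [set` A]) X @^-1` [set x].
  apply/seteqP; split => [w Aw|w [x Ax /= Xwx]]; first by exists (X w).
  by rewrite /preimage/= Xwx.
rewrite measure_fin_bigcup//; last by move=> x y _ _ [w [/= -> ->]].
rewrite -(@bigfs _ _ _ _ (index_enum U))// ?index_enum_uniq//; last first.
  by move=> x _; rewrite mem_index_enum.
by rewrite -sumEFin; apply: eq_bigr => x _; exact: Pc.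
Qed.

Lemma measurable_tuple_set1 n (x : n.-tuple bool) : measurable [set x].
Proof.
have -> : [set x] =
    \bigcap_(i in [set: 'I_n]) (@tnth n bool ^~ i) @^-1` [set tnth x i].
  apply/seteqP; split => [_ -> //|y xy]; apply: eq_from_tnth => i.
  exact: xy.
apply: fin_bigcap_measurable => // i _; rewrite -[X in measurable X]setTI.
exact: measurable_tnth.
Qed.

Lemma tuple_preimage_set1 (T U : Type) (n : nat) (X : 'I_n -> T -> U)
    (x : n.-tuple U) :
  (fun w => [tuple X i w | i < n]) @^-1` [set x] =
  \bigcap_(i in [set` [set: 'I_n]%SET]) X i @^-1` [set tnth x i].
Proof.
apply/seteqP; split => [w <- i _ /=|w Xx]; first by rewrite tnth_mktuple.
by apply: eq_from_tnth => i; rewrite tnth_mktuple; apply: Xx; rewrite /= inE.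
Qed.

(** Independence is applied to the full index set, with one singleton event per coordinate. *)
Lemma probability_bernoulli_tuple d (T : measurableType d) (R : realType)
    (Q : probability T R) (n : nat) (p : R) (X : 'I_n -> {RV Q >-> bool})
    (x : n.-tuple bool) : 0 <= p <= 1 ->
  (forall i (A : set bool), distribution Q (X i) A = bernoulli_prob p A) ->
  mutually_independent X ->
  Q ((fun w => [tuple X i w | i < n]) @^-1` [set x]) =
    (\prod_(c <- x) (if c then p else 1 - p))%:E.
Proof.
move=> p01 X_bern X_indep; rewrite tuple_preimage_set1.
rewrite (X_indep _ (fun i => [set tnth x i]))//.
rewrite big_tuple (big_morph EFin (@EFinM R) (erefl 1%:E)).
apply: eq_big => [i|i _]; first by rewrite inE.
have := X_bern i [set tnth x i]; rewrite /distribution /pushforward => ->.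
rewrite bernoulli_probE// !diracE.
case: (tnth x i).
  by rewrite mem_set// memNset// mule1 mule0 adde0.
by rewrite memNset// mem_set// mule1 mule0 add0e.
Qed.

Theorem theorem7p1 (R : realType) (n k : nat) (n_gt0 : (0 < n)%N)
    (k_gt0 : (0 < k)%N) (k_le : k%:R <= n%:R / 2 :> R)
    (S : Type) (s : nat) (s_le : (s <= n)%N) (F : n.-tuple bool -> S)
    (F_dep : depends_only_on_first s F)
    (d1 : measure_display) (T1 : measurableType d1) (P : probability T1 R)
    (sigma : {RV P >-> n.-tuple bool})
    (sigma_unif : uniformly_distributed sigma (Slice n k))
    (d2 : measure_display) (T2 : measurableType d2) (Q : probability T2 R)
    (beta : 'I_n -> {RV Q >-> bool})
    (beta_bern : forall (i : 'I_n) (A : set bool),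
       distribution Q (beta i) A = bernoulli_prob (k%:R / n%:R : R) A)
    (beta_indep : mutually_independent beta) :
  (dTV discrete_measurable
       (law P (fun w => F (sigma w)))
       (law Q (fun w => F [tuple beta i w | i < n]))
   <= ((Num.max s%:R (2 * n%:R / k%:R) - 1) / (n%:R - 1))%:E)%E.
Proof.
(* From [1 <= k <= n / 2] follow [n >= 2], so that [n - 1] is positive, and [k < n], so that [k / n]
   lies strictly between 0 and 1. *)
have k2n : (k * 2 <= n)%N.
  by move: k_le; rewrite ler_pdivlMr// -natrM ler_nat.
have kn : (0 < k < n)%N by lia.
have n1 : (1 < n)%N by lia.
have nR : 0 < n%:R :> R by rewrite ltr0n.
have p01 : 0 <= (k%:R / n%:R : R) <= 1.
  by rewrite divr_ge0//= ler_pdivrMr// mul1r ler_nat; lia.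
apply: ge_ereal_sup => _ [E _ <-]; rewrite /law.
pose A (x : n.-tuple bool) := `[< E (F x) >].
have A_dep : depends_only_on_first s A.
  by move=> x y xy; rewrite /A (F_dep x y xy).
have AE : [set x | A x] = F @^-1` E.
  by apply/seteqP; split => x /= /asboolP.
have -> : P ((fun w => F (sigma w)) @^-1` E) =
    (\sum_(x | A x) (x \in Slice n k)%:R / #|Slice n k|%:R)%:E.
  rewrite -(@probability_preimage_fin _ _ _ P _ sigma) ?AE// => x.
  by apply: measurable_funPTI; exact: measurable_tuple_set1.
have -> : Q ((fun w => F [tuple beta i w | i < n]) @^-1` E) =
    (\sum_(x | A x) \prod_(c <- x)
       (if c then k%:R / n%:R else 1 - k%:R / n%:R))%:E.
  rewrite -(@probability_preimage_fin _ _ _ Q _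
    (fun w => [tuple beta i w | i < n])) ?AE// => x.
    rewrite tuple_preimage_set1; apply: fin_bigcap_measurable => // i _.
    exact: measurable_funPTI.
  exact: probability_bernoulli_tuple.
rewrite -EFinB abse_EFin lee_fin.
apply: (le_trans (slice_bernoulli_bound_le R s_le n1 kn A_dep)).
(* What remains is [max(s, 1) <= max(s, 2n / k)], which holds because [k <= 2n]. *)
rewrite ler_wpM2r ?invr_ge0 ?subr_ge0 ?ler1n// lerB//.
rewrite -maxEnat natr_max le_max2// ler_pdivlMr ?ltr0n// mul1r -natrM ler_nat; lia.
Qed.
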